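(* The twisted quantized enveloping algebra $U_q^{tw}(\mathfrak{gl}_n)$ is a left coideal subalgebra of $U_q(\mathfrak{sp}_{2n})$, i.e. $\Delta'(U_q^{tw}(\mathfrak{gl}_n))\subseteq U_q(\mathfrak{sp}_{2n})\otimes U_q^{tw}(\mathfrak{gl}_n)$. More precisely, the image of the generators $s_{ij}$ under the coproduct $\Delta'$ is $$\Delta'(s_{ij})=\sum_{k,l=1}^{2n}t_{ik}\overline{t}_{jl}\otimes s_{kl}.$$
   Context: Fix $n\ge1$; $q$ is a formal variable. For $1\le i\le 2n$ put $i'=2n+1-i$, $\epsilon_i=1$ if $i\le n$, $\epsilon_i=-1$ if $i>n$, and $(\rho_1,\dots,\rho_{2n})=(n,\dots,1,-1,\dots,-n)$. Let $e_{ij}$ be the elementary $2n\times 2n$ matrices, $D=\mathrm{diag}(q^{n},\dots,q,q^{-1},\dots,q^{-n})$, $J=\sum_k\epsilon_ke_{kk}$, and $$R=\sum_{i,j}q^{\delta_{ij}-\delta_{ij'}}e_{ii}\otimes e_{jj}+(q-q^{-1})\sum_{i<j}e_{ij}\otimes e_{ji}-(q-q^{-1})\sum_{i<j}q^{\rho_j-\rho_i}\epsilon_i\epsilon_j\,e_{ij}\otimes e_{i'j'} .$$ $u$ is the usual transposition $e_{ij}^u=e_{ji}$ and $t$ is the transposition $e_{ij}^t=\epsilon_i\epsilon_je_{j'i'}$ (acting on the matrix part only). For a matrix $X$ over an algebra, $X_1,X_2$ denote $X$ placed in the first, resp. second, copy of $\mathrm{End}\,\mathbb{C}^{2n}$.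 $U_q(\mathfrak{sp}_{2n})$ is the $\mathbb{C}(q)$-algebra generated by $t_{ij},\overline{t}_{ij}$ ($1\le i,j\le 2n$), with $T=(t_{ij})$, $\overline{T}=(\overline{t}_{ij})$, subject to $t_{ij}=\overline{t}_{ji}=0$ for $i<j$; $t_{ii}\overline{t}_{ii}=\overline{t}_{ii}t_{ii}=1$; $RT_1T_2=T_2T_1R$, $R\overline{T}_1\overline{T}_2=\overline{T}_2\overline{T}_1R$, $R\overline{T}_1T_2=T_2\overline{T}_1R$; and $TDT^tD^{-1}=\overline{T}D\overline{T}^tD^{-1}=I$, $DT^tD^{-1}T=D\overline{T}^tD^{-1}\overline{T}=I$. It is a Hopf algebra with coproduct $\Delta'(t_{ij})=\sum_{k=1}^{2n}t_{ik}\otimes t_{kj}$, $\Delta'(\overline{t}_{ij})=\sum_{k=1}^{2n}\overline{t}_{ik}\otimes\overline{t}_{kj}$. $U_q^{tw}(\mathfrak{gl}_n)$ is the subalgebra of $U_q(\mathfrak{sp}_{2n})$ generated by the entries $s_{ij}=\sum_{k=j}^{i}\epsilon_kt_{ik}\overline{t}_{jk}$ of the matrix $S=TJ\overline{T}^u$. *)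

(* Defs.v *)
From HB Require Import structures.
From mathcomp Require Import all_boot all_order all_algebra.
From mathcomp Require Import boolp classical_sets.
From mathcomp Require Import reals.
From mathcomp.real_closed Require Import complex mxtens.
From mathcomp.multinomials Require Import monalg.

Set Implicit Arguments.
Unset Strict Implicit.
Unset Printing Implicit Defensive.

Import GRing.Theory.
Local Open Scope ring_scope.
Local Open Scope quotient_scope.
Local Open Scope complex_scope.

(** * Associative algebras over a field *)

Lemma malg_scaleAr (M : monomType) (R : comNzRingType) (c : R)
  (x y : {malg R[M]}) : c *: (x * y) = x * (c *: y).
Proof.
have comC : x * c%:MP = c%:MP * x.
  rewrite !malgM_def fgmulgU fgmulUg; apply: eq_bigr => m _.
  by rewrite mulm1 mul1m mulrC.
by rewrite -(mul_malgC c (x * y)) -(mul_malgC c y) (mulrA x) comC -mulrA.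
Qed.

Section FreeAlgebra.
Variables (K : fieldType) (I : choiceType).

Definition free_alg : Type := {malg K[{fmonom I}]}.

HB.instance Definition _ := GRing.Lalgebra.on free_alg.

Lemma free_alg_scaleAr (c : K) (x y : free_alg) : c *: (x * y) = x * (c *: y).
Proof. exact: malg_scaleAr. Qed.

HB.instance Definition _ := GRing.Lalgebra_isAlgebra.Build K free_alg
  free_alg_scaleAr.

End FreeAlgebra.

HB.lock Definition free_gen (K : fieldType) (I : choiceType) (i : I) :
  free_alg K I := << FMonom [:: i] >>.

Section FreeLift.
Variables (K : fieldType) (I : choiceType).
Local Notation free_alg := (free_alg K I).
Local Notation free_gen := (@free_gen K I).
Variables (A : algType K) (f : I -> A).

Definition free_eval (m : {fmonom I}) : A := \prod_(i <- (m : seq I)) f i.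

Lemma free_eval_mmorphism : mmorphism free_eval.
Proof.
split=> [m1 m2|]; first by rewrite /free_eval fmM big_cat.
by rewrite /free_eval fm1 big_nil.
Qed.

HB.instance Definition _ := isMultiplicative.Build {fmonom I} A free_eval
  free_eval_mmorphism.

Definition free_lift (x : free_alg) : A := mmap (in_alg A) free_eval x.

Lemma free_lift_comm (g : {malg K[{fmonom I}]}) m m' :
  GRing.comm (in_alg A g@_m) (free_eval m').
Proof. by rewrite /GRing.comm /= mulr_algl mulr_algr. Qed.

Lemma free_lift_is_zmod_morphism : zmod_morphism free_lift.
Proof. by move=> x y; rewrite /free_lift raddfB. Qed.

Lemma free_lift_is_monoid_morphism : monoid_morphism free_lift.
Proof. by case: (commr_mmap_is_multiplicative free_lift_comm). Qed.

Lemma free_lift_is_scalable : scalable free_lift.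
Proof. by move=> c x; rewrite /free_lift mmapZ /= mulr_algl. Qed.

HB.instance Definition _ := GRing.isZmodMorphism.Build free_alg A free_lift
  free_lift_is_zmod_morphism.
HB.instance Definition _ := GRing.isMonoidMorphism.Build free_alg A free_lift
  free_lift_is_monoid_morphism.
HB.instance Definition _ := GRing.isScalable.Build K free_alg A *:%R free_lift
  free_lift_is_scalable.

Lemma free_lift_gen (i : I) : free_lift (free_gen i) = f i.
Proof.
by rewrite /free_lift unlock mmapU /= scale1r mul1r /free_eval big_seq1.
Qed.

End FreeLift.

Section QuotientAlgebra.
Variables (K : fieldType) (A : algType K).

Inductive ideal_gen (X : set A) : set A :=
| ideal_gen_mem x : X x -> ideal_gen X x
| ideal_gen0 : ideal_gen X 0
| ideal_genD x y : ideal_gen X x -> ideal_gen X y -> ideal_gen X (x + y)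
| ideal_genMl a x : ideal_gen X x -> ideal_gen X (a * x)
| ideal_genMr a x : ideal_gen X x -> ideal_gen X (x * a).

Variables (X : set A) (X1 : ~ ideal_gen X 1).

Definition ideal_pred : {pred A} := fun x => `[< ideal_gen X x >].

Lemma ideal_predP x : reflect (ideal_gen X x) (x \in ideal_pred).
Proof. exact: asboolP. Qed.

Lemma ideal_pred_zmod_closed : zmod_closed ideal_pred.
Proof.
split=> [|x y /ideal_predP Ix /ideal_predP Iy]; apply/ideal_predP.
  exact: ideal_gen0.
by apply: ideal_genD => //; rewrite -mulN1r; apply: ideal_genMl.
Qed.

HB.instance Definition _ := GRing.isZmodClosed.Build A ideal_pred
  ideal_pred_zmod_closed.

(* The proof [X1] that the ideal is proper is needed because the library's
   [algType] only contains nonzero algebras. *)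
Definition quot_alg of ~ ideal_gen X 1 : Type := Quotient.quot ideal_pred.
Local Notation Q := (quot_alg X1).

HB.instance Definition _ := GRing.Zmodule.on Q.

Definition quot_pi (x : A) : Q := \pi_(Quotient.quot ideal_pred) x.

Lemma quot_piP x y : reflect (quot_pi x = quot_pi y) (x - y \in ideal_pred).
Proof.
by rewrite /quot_pi (Quotient.idealrBE ideal_pred); apply: eqP.
Qed.

Lemma quot_pi_surj (u : Q) : {x | u = quot_pi x}.
Proof. by exists (repr (u : Quotient.quot ideal_pred)); rewrite /quot_pi reprK. Qed.

Lemma quot_pi_is_zmod_morphism : zmod_morphism quot_pi.
Proof. by move=> x y; rewrite /quot_pi raddfB. Qed.

HB.instance Definition _ := GRing.isZmodMorphism.Build A Q quot_pi
  quot_pi_is_zmod_morphism.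

Definition quot_repr (u : Q) : A := sval (quot_pi_surj u).

Lemma quot_reprK : cancel quot_repr quot_pi.
Proof. by move=> u; rewrite /quot_repr; case: quot_pi_surj. Qed.

Definition quot_mul (u v : Q) : Q := quot_pi (quot_repr u * quot_repr v).
Definition quot_scale (c : K) (u : Q) : Q := quot_pi (c *: quot_repr u).

Lemma quot_piM x y : quot_pi (x * y) = quot_mul (quot_pi x) (quot_pi y).
Proof.
apply/quot_piP; set x' := quot_repr _; set y' := quot_repr _.
have Ix : x - x' \in ideal_pred by apply/quot_piP; rewrite quot_reprK.
have Iy : y - y' \in ideal_pred by apply/quot_piP; rewrite quot_reprK.
have -> : x * y - x' * y' = (x - x') * y + x' * (y - y').
  by rewrite mulrBl mulrBr addrA subrK.
apply/ideal_predP/ideal_genD.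
  by apply: ideal_genMr; apply/ideal_predP.
by apply: ideal_genMl; apply/ideal_predP.
Qed.

Lemma quot_piZ c x : quot_pi (c *: x) = quot_scale c (quot_pi x).
Proof.
apply/quot_piP; rewrite -scalerBr -mulr_algl; apply/ideal_predP/ideal_genMl.
by apply/ideal_predP/quot_piP; rewrite quot_reprK.
Qed.

Lemma quot_mulA : associative quot_mul.
Proof.
by move=> u v w; rewrite -(quot_reprK u) -(quot_reprK v) -(quot_reprK w)
  -!quot_piM mulrA.
Qed.
Lemma quot_mul1 : left_id (quot_pi 1) quot_mul.
Proof. by move=> u; rewrite -(quot_reprK u) -!quot_piM mul1r. Qed.
Lemma quot_mulr1 : right_id (quot_pi 1) quot_mul.
Proof. by move=> u; rewrite -(quot_reprK u) -!quot_piM mulr1. Qed.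
Lemma quot_mulDl : left_distributive quot_mul +%R.
Proof.
by move=> u v w; rewrite -(quot_reprK u) -(quot_reprK v) -(quot_reprK w)
  -!(raddfD quot_pi, quot_piM) mulrDl.
Qed.
Lemma quot_mulDr : right_distributive quot_mul +%R.
Proof.
by move=> u v w; rewrite -(quot_reprK u) -(quot_reprK v) -(quot_reprK w)
  -!(raddfD quot_pi, quot_piM) mulrDr.
Qed.
Lemma quot_oner_neq0 : quot_pi 1 != 0.
Proof.
apply/eqP => e; apply: X1; apply/ideal_predP; rewrite -[1]subr0.
by apply/quot_piP; rewrite e raddf0.
Qed.

HB.instance Definition _ := GRing.Zmodule_isNzRing.Build Q
  quot_mulA quot_mul1 quot_mulr1 quot_mulDl quot_mulDr quot_oner_neq0.

Lemma quot_scaleA a b (u : Q) :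
  quot_scale a (quot_scale b u) = quot_scale (a * b) u.
Proof. by rewrite -(quot_reprK u) -!quot_piZ scalerA. Qed.
Lemma quot_scale1 : left_id 1 quot_scale.
Proof. by move=> u; rewrite -(quot_reprK u) -!quot_piZ scale1r. Qed.
Lemma quot_scaleDr : right_distributive quot_scale +%R.
Proof.
by move=> a u v; rewrite -(quot_reprK u) -(quot_reprK v)
  -!(raddfD quot_pi, quot_piZ) scalerDr.
Qed.
Lemma quot_scaleDl (u : Q) : {morph quot_scale^~ u : a b / a + b}.
Proof.
by move=> a b; rewrite -(quot_reprK u) -!quot_piZ -(raddfD quot_pi) scalerDl.
Qed.

HB.instance Definition _ := GRing.Zmodule_isLmodule.Build K Q
  quot_scaleA quot_scale1 quot_scaleDr quot_scaleDl.

Lemma quot_scaleAl (a : K) (u v : Q) : a *: (u * v) = (a *: u) * v.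
Proof.
by rewrite -(quot_reprK u) -(quot_reprK v) -[LHS]/(quot_scale _ (quot_mul _ _))
  -[RHS]/(quot_mul (quot_scale _ _) _) -!(quot_piZ, quot_piM) scalerAl.
Qed.

HB.instance Definition _ := GRing.Lmodule_isLalgebra.Build K Q quot_scaleAl.

Lemma quot_scaleAr (a : K) (u v : Q) : a *: (u * v) = u * (a *: v).
Proof.
by rewrite -(quot_reprK u) -(quot_reprK v) -[LHS]/(quot_scale _ (quot_mul _ _))
  -[RHS]/(quot_mul _ (quot_scale _ _)) -!(quot_piZ, quot_piM) scalerAr.
Qed.

HB.instance Definition _ := GRing.Lalgebra_isAlgebra.Build K Q quot_scaleAr.

Lemma quot_pi_is_monoid_morphism : monoid_morphism quot_pi.
Proof. by split=> // x y; rewrite quot_piM. Qed.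
Lemma quot_pi_is_scalable : scalable quot_pi.
Proof. by move=> c x; rewrite quot_piZ. Qed.

HB.instance Definition _ := GRing.isMonoidMorphism.Build A Q quot_pi
  quot_pi_is_monoid_morphism.
HB.instance Definition _ := GRing.isScalable.Build K A Q *:%R quot_pi
  quot_pi_is_scalable.

Lemma quot_pi0 x : X x -> quot_pi x = 0.
Proof.
move=> Xx; rewrite -(raddf0 quot_pi); apply/quot_piP; rewrite subr0.
exact/ideal_predP/ideal_gen_mem.
Qed.

Section Lift.
Variables (B : algType K) (f : {lrmorphism A -> B}).
Hypothesis fX : forall x, X x -> f x = 0.

Lemma ideal_gen_ker x : ideal_gen X x -> f x = 0.
Proof.
elim=> {x} [x /fX //||x y _ fx _ fy|a x _ fx|a x _ fx]; first exact: rmorph0.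
- by rewrite rmorphD /= fx fy addr0.
- by rewrite rmorphM /= fx mulr0.
- by rewrite rmorphM /= fx mul0r.
Qed.

Definition quot_lift of (forall x, X x -> f x = 0) := fun u : Q => f (quot_repr u).
Local Notation lift := (quot_lift fX).

Lemma quot_lift_pi x : lift (quot_pi x) = f x.
Proof.
apply/eqP; rewrite -subr_eq0 -rmorphB /=; apply/eqP/ideal_gen_ker/ideal_predP.
by apply/quot_piP; rewrite quot_reprK.
Qed.

Lemma quot_lift_is_zmod_morphism : zmod_morphism lift.
Proof.
move=> u v; rewrite -(quot_reprK u) -(quot_reprK v) -(raddfB quot_pi) !quot_lift_pi.
by rewrite rmorphB.
Qed.
Lemma quot_lift_is_monoid_morphism : monoid_morphism lift.
Proof.
split=> [|u v]; first by rewrite -(rmorph1 quot_pi) quot_lift_pi rmorph1.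
by rewrite -(quot_reprK u) -(quot_reprK v) -rmorphM !quot_lift_pi rmorphM.
Qed.
Lemma quot_lift_is_scalable : scalable lift.
Proof.
by move=> c u; rewrite -(quot_reprK u) -linearZ !quot_lift_pi linearZ.
Qed.

HB.instance Definition _ := GRing.isZmodMorphism.Build Q B lift
  quot_lift_is_zmod_morphism.
HB.instance Definition _ := GRing.isMonoidMorphism.Build Q B lift
  quot_lift_is_monoid_morphism.
HB.instance Definition _ := GRing.isScalable.Build K Q B *:%R lift
  quot_lift_is_scalable.

End Lift.
End QuotientAlgebra.

(* Used only to see that a tensor product of nonzero algebras is nonzero. *)
Lemma exists_augmentation (K : fieldType) (A : algType K) :
  exists f : A -> K, [/\ forall x y, f (x + y) = f x + f y,
    forall c x, f (c *: x) = c * f x & f 1 = 1].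
Proof.
pose P (M : set A) := ~ M 1 /\ forall c x y, M x -> M y -> M (c *: x + y).
have [M [[M1 Mlin] Mmax]] : exists M, P M /\ forall N, (M `<` N)%classic -> ~ P N.
  apply: Zorn_bigcup => F FP Ftot; split=> [[N /FP[]] //|c x y [N FN Nx] [N' FN' Ny]].
  have [NN'|N'N] := Ftot _ _ FN FN'.
    by exists N' => //; apply: (FP _ FN').2 => //; apply: NN'.
  by exists N => //; apply: (FP _ FN).2 => //; apply: N'N.
have M0 : M 0.
  have [//|nM0] := pselect (M 0).
  have Mempty x : ~ M x.
    by move=> Mx; apply: nM0; have := Mlin (-1) _ _ Mx Mx; rewrite scaleN1r addNr.
  exfalso; apply: (Mmax [set 0]%classic).
    by split=> [x /Mempty //|/(_ 0 erefl)].
  split=> [/= /eqP|c x y /= -> ->]; first by rewrite oner_eq0.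
  by rewrite scaler0 addr0.
have MD x y : M x -> M y -> M (x + y).
  by move=> Mx My; rewrite -[x]scale1r; apply: Mlin.
have MZ c x : M x -> M (c *: x) by move=> Mx; rewrite -[_ *: _]addr0; apply: Mlin.
have MB x y : M x -> M y -> M (x - y).
  by move=> Mx My; rewrite addrC -scaleN1r; apply: Mlin.
have uniq c d x : M (x - c%:A) -> M (x - d%:A) -> c = d.
  move=> Mc Md; apply/eqP; rewrite -subr_eq0; apply/negPn/negP => cd; apply: M1.
  have := MZ (c - d)^-1 _ (MB _ _ Md Mc).
  have -> : x - d%:A - (x - c%:A) = (c - d)%:A.
    by rewrite opprB addrC addrA subrK scalerBl.
  by rewrite scalerA mulVf // scale1r.
have ex x : exists c, M (x - c%:A).
  have [Mx|Mx] := pselect (M x); first by exists 0; rewrite scale0r subr0.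
  pose N := [set y | exists c m, M m /\ y = c *: x + m]%classic.
  have [[c [m [Mm e]]]|N1] := pselect (N 1); last first.
    exfalso; apply: (Mmax N).
      split=> [m Mm|NM]; first by exists 0, m; rewrite scale0r add0r.
      by apply/Mx/NM; exists 1, 0; rewrite scale1r addr0.
    split=> // c _ _ [a [m [Mm ->]]] [b [m' [Mm' ->]]].
    exists (c * a + b), (c *: m + m'); split; first exact: Mlin.
    by rewrite scalerDr scalerA scalerDl addrACA.
  have c0 : c != 0.
    by apply/eqP => c0; apply: M1; rewrite e c0 scale0r add0r.
  exists c^-1; rewrite e scalerDr scalerA mulVf // scale1r opprD addrA subrr add0r.
  by rewrite -scalerN -scaleN1r scalerA; apply: MZ.
exists (fun x => sval (cid (ex x))); split=> [x y|c x|].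
- case: (cid (ex (x + y))) => d Md; case: (cid (ex x)) => a Ma.
  case: (cid (ex y)) => b Mb /=; apply: uniq Md _.
  by rewrite scalerDl opprD addrACA; apply: MD.
- case: (cid (ex (c *: x))) => d Md; case: (cid (ex x)) => a Ma /=.
  by apply: uniq Md _; rewrite -scalerA -scalerBr; apply: MZ.
- case: (cid (ex 1)) => a Ma /=; apply: uniq Ma _.
  by rewrite scale1r subrr.
Qed.

(** ** Tensor products *)

Section Tensor.
Variables (K : fieldType) (A B : algType K).

(* Formal sums of pairs [(a, b)], modulo the relations making [(a, b)]
   bilinear over [K]. *)
Inductive tens_eqv : seq (A * B) -> seq (A * B) -> Prop :=
| tens_refl s : tens_eqv s s
| tens_sym s t : tens_eqv s t -> tens_eqv t s
| tens_trans s t u : tens_eqv s t -> tens_eqv t u -> tens_eqv s u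
| tens_cat s s' t t' :
    tens_eqv s s' -> tens_eqv t t' -> tens_eqv (s ++ t) (s' ++ t')
| tens_catC s t : tens_eqv (s ++ t) (t ++ s)
| tens_eqv0 b : tens_eqv [:: (0, b)] [::]
| tens_eqvDl a a' b : tens_eqv [:: (a + a', b)] [:: (a, b); (a', b)]
| tens_eqvDr a b b' : tens_eqv [:: (a, b + b')] [:: (a, b); (a, b')]
| tens_eqvZ (c : K) a b : tens_eqv [:: (c *: a, b)] [:: (a, c *: b)].

Definition tens_rel : rel (seq (A * B)) := fun s t => `[< tens_eqv s t >].

Lemma tens_rel_equiv : equiv_class_of tens_rel.
Proof.
split=> [s|s t|t s u]; first exact/asboolP/tens_refl.
  by apply/asboolP/asboolP => /tens_sym.
by move=> /asboolP st /asboolP tu; apply/asboolP; apply: tens_trans st tu.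
Qed.

Canonical tens_rel_canonical := EquivRelPack tens_rel_equiv.
Canonical tens_encModRel := defaultEncModRel tens_rel.

Definition tens : Type := {eq_quot tens_rel}.
HB.instance Definition _ := Choice.on tens.

Definition tens_pi (s : seq (A * B)) : tens := \pi_({eq_quot tens_rel}) s.
Definition tens_repr (x : tens) : seq (A * B) := repr (x : {eq_quot tens_rel}).

Lemma tens_reprK : cancel tens_repr tens_pi.
Proof. by move=> x; rewrite /tens_pi /tens_repr reprK. Qed.

Lemma tens_piP s t : tens_pi s = tens_pi t <-> tens_eqv s t.
Proof.
split=> [/eqmodP/asboolP //|st].
by apply/eqmodP/asboolP.
Qed.

Lemma tens_eqvK s : tens_eqv (tens_repr (tens_pi s)) s.
Proof. by apply/tens_piP; rewrite tens_reprK. Qed.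

Definition tpure (a : A) (b : B) : tens := tens_pi [:: (a, b)].

Definition tens_opp_seq (s : seq (A * B)) := [seq (- p.1, p.2) | p <- s].

Lemma tens_opp_eqv s t :
  tens_eqv s t -> tens_eqv (tens_opp_seq s) (tens_opp_seq t).
Proof.
elim=> {s t}.
- by move=> s; apply: tens_refl.
- by move=> s t _; apply: tens_sym.
- by move=> s t u _ st _; apply: tens_trans.
- by move=> s s' t t' _ ss' _ tt'; rewrite /tens_opp_seq !map_cat; apply: tens_cat.
- by move=> s t; rewrite /tens_opp_seq !map_cat; apply: tens_catC.
- by move=> b /=; rewrite oppr0; apply: tens_eqv0.
- by move=> a a' b /=; rewrite opprD; apply: tens_eqvDl.
- by move=> a b b' /=; apply: tens_eqvDr.
- by move=> c a b /=; rewrite -scalerN; apply: tens_eqvZ.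
Qed.

Definition tens_zero : tens := tens_pi [::].
Definition tens_opp (x : tens) : tens := tens_pi (tens_opp_seq (tens_repr x)).
Definition tens_add (x y : tens) : tens := tens_pi (tens_repr x ++ tens_repr y).

Lemma tens_pi_opp s : tens_pi (tens_opp_seq s) = tens_opp (tens_pi s).
Proof. by apply/tens_piP/tens_opp_eqv/tens_sym/tens_eqvK. Qed.

Lemma tens_pi_cat s t : tens_pi (s ++ t) = tens_add (tens_pi s) (tens_pi t).
Proof. by apply/tens_piP/tens_sym/tens_cat; apply: tens_eqvK. Qed.

Lemma tens_addA : associative tens_add.
Proof.
by move=> x y z; rewrite -(tens_reprK x) -(tens_reprK y) -(tens_reprK z)
  -!tens_pi_cat catA.
Qed.
Lemma tens_addC : commutative tens_add.
Proof.
move=> x y; rewrite -(tens_reprK x) -(tens_reprK y) -!tens_pi_cat.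
exact/tens_piP/tens_catC.
Qed.
Lemma tens_add0 : left_id tens_zero tens_add.
Proof. by move=> x; rewrite -(tens_reprK x) -!tens_pi_cat. Qed.
Lemma tens_addN : left_inverse tens_zero tens_opp tens_add.
Proof.
move=> x; rewrite -(tens_reprK x) -tens_pi_opp -tens_pi_cat.
rewrite -/tens_zero; elim: (tens_repr x) => [//|[a b] s IHs].
have neg : tens_add (tens_pi [:: (- a, b)]) (tens_pi [:: (a, b)]) = tens_zero.
  rewrite -tens_pi_cat; apply/tens_piP/(tens_trans (tens_sym (tens_eqvDl _ _ _))).
  by rewrite addNr; apply: tens_eqv0.
rewrite -[_ ++ _]/([:: (- a, b)] ++ (tens_opp_seq s ++ ([:: (a, b)] ++ s))).
rewrite !(tens_pi_cat _ (_ ++ _)) (tens_pi_cat _ s).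
rewrite (tens_addA (tens_pi (tens_opp_seq s))).
rewrite (tens_addC (tens_pi (tens_opp_seq s))) -tens_addA -tens_pi_cat IHs.
by rewrite (tens_addC _ tens_zero) tens_add0.
Qed.

HB.instance Definition _ := GRing.isZmodule.Build tens
  tens_addA tens_addC tens_add0 tens_addN.

Lemma tens_pi_cons p s : tens_pi (p :: s) = tpure p.1 p.2 + tens_pi s.
Proof. by rewrite -cat1s tens_pi_cat; case: p. Qed.

Lemma tens_pi_sum s : tens_pi s = \sum_(p <- s) tpure p.1 p.2.
Proof.
by elim: s => [|p s IHs]; rewrite ?big_nil // big_cons tens_pi_cons IHs.
Qed.

Lemma tens_ind (P : tens -> Prop) : P 0 ->
  (forall a b x, P x -> P (tpure a b + x)) -> forall x, P x.
Proof.
move=> P0 PD x; rewrite -(tens_reprK x).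
by elim: (tens_repr x) => [|p s IHs] //; rewrite tens_pi_cons; apply: PD.
Qed.

Lemma tpureDl a a' b : tpure (a + a') b = tpure a b + tpure a' b.
Proof. by rewrite -[RHS]/(tens_add _ _) -tens_pi_cat; apply/tens_piP/tens_eqvDl. Qed.
Lemma tpureDr a b b' : tpure a (b + b') = tpure a b + tpure a b'.
Proof. by rewrite -[RHS]/(tens_add _ _) -tens_pi_cat; apply/tens_piP/tens_eqvDr. Qed.
Lemma tpureZ (c : K) a b : tpure (c *: a) b = tpure a (c *: b).
Proof. exact/tens_piP/tens_eqvZ. Qed.

Section Lift.
Variables (V : zmodType) (h : A -> B -> V).

Definition balanced := [/\ forall a a' b, h (a + a') b = h a b + h a' b,
  forall a b b', h a (b + b') = h a b + h a b' &
  forall (c : K) a b, h (c *: a) b = h a (c *: b)].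

Definition tens_lift (x : tens) : V := \sum_(p <- tens_repr x) h p.1 p.2.

Hypothesis h_bal : balanced.

Lemma tens_eqv_lift s t : tens_eqv s t ->
  \sum_(p <- s) h p.1 p.2 = \sum_(p <- t) h p.1 p.2.
Proof.
case: h_bal => hDl hDr hZ.
elim=> {s t} [//|s t _ -> //|s t u _ -> _ -> //||||||c a b].
- by move=> s s' t t' _ ss' _ tt'; rewrite !big_cat /= ss' tt'.
- by move=> s t; rewrite !big_cat /= addrC.
- move=> b; rewrite big_seq1 big_nil /=.
  by apply: (addrI (h 0 b)); rewrite -hDl !addr0.
- by move=> a a' b; rewrite !big_cons !big_nil !addr0 hDl.
- by move=> a b b'; rewrite !big_cons !big_nil !addr0 hDr.
- by rewrite !big_cons !big_nil !addr0 hZ.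
Qed.

Lemma tens_lift_pi s : tens_lift (tens_pi s) = \sum_(p <- s) h p.1 p.2.
Proof. exact/tens_eqv_lift/tens_eqvK. Qed.

Lemma tens_lift_pure a b : tens_lift (tpure a b) = h a b.
Proof. by rewrite tens_lift_pi big_seq1. Qed.

Lemma tens_lift0 : tens_lift 0 = 0.
Proof. by rewrite -[0 in LHS]/(tens_pi [::]) tens_lift_pi big_nil. Qed.

Lemma tens_liftD x y : tens_lift (x + y) = tens_lift x + tens_lift y.
Proof.
rewrite -(tens_reprK x) -(tens_reprK y) -[tens_pi _ + _]/(tens_add _ _).
by rewrite -tens_pi_cat !tens_lift_pi big_cat.
Qed.

End Lift.

Definition tens_scale (c : K) (x : tens) : tens :=
  tens_lift (fun a b => tpure (c *: a) b) x.

Definition tens_mul (x y : tens) : tens :=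
  tens_lift (fun a b => tens_lift (fun a' b' => tpure (a * a') (b * b')) y) x.

Lemma tens_scale_bal c : balanced (fun a b => tpure (c *: a) b).
Proof.
split=> [a a' b|a b b'|d a b].
- by rewrite scalerDr tpureDl.
- by rewrite tpureDr.
- by rewrite !tpureZ !scalerA mulrC.
Qed.

Lemma tens_mul_bal1 a b : balanced (fun a' b' => tpure (a * a') (b * b')).
Proof.
split=> [a' a'' b'|a' b' b''|d a' b'].
- by rewrite mulrDr tpureDl.
- by rewrite mulrDr tpureDr.
- by rewrite -!scalerAr tpureZ.
Qed.

Lemma tens_mul_bal2 y : balanced
  (fun a b => tens_lift (fun a' b' => tpure (a * a') (b * b')) y).
Proof.
elim/tens_ind: y => [|a' b' y [IH1 IH2 IH3]].
  by split=> *; rewrite !(tens_lift0 (tens_mul_bal1 _ _)) ?addr0.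
split=> *; rewrite !(tens_liftD (tens_mul_bal1 _ _)).
- by rewrite !(tens_lift_pure (tens_mul_bal1 _ _)) IH1 mulrDl tpureDl addrACA.
- by rewrite !(tens_lift_pure (tens_mul_bal1 _ _)) IH2 mulrDl tpureDr addrACA.
- by rewrite !(tens_lift_pure (tens_mul_bal1 _ _)) IH3 -!scalerAl tpureZ.
Qed.

Lemma tens_scaleD c x y : tens_scale c (x + y) = tens_scale c x + tens_scale c y.
Proof. exact: tens_liftD (tens_scale_bal c) x y. Qed.
Lemma tens_scale0 c : tens_scale c 0 = 0.
Proof. exact: tens_lift0 (tens_scale_bal c). Qed.
Lemma tens_scale_pure c a b : tens_scale c (tpure a b) = tpure (c *: a) b.
Proof. exact: tens_lift_pure (tens_scale_bal c) a b. Qed.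

Lemma tens_mulDl x y z : tens_mul (x + y) z = tens_mul x z + tens_mul y z.
Proof. exact: tens_liftD (tens_mul_bal2 z) x y. Qed.
Lemma tens_mul0l z : tens_mul 0 z = 0.
Proof. exact: tens_lift0 (tens_mul_bal2 z). Qed.
Lemma tens_mulDr x y z : tens_mul x (y + z) = tens_mul x y + tens_mul x z.
Proof.
elim/tens_ind: x => [|a b x IHx]; first by rewrite !tens_mul0l addr0.
rewrite !tens_mulDl IHx addrACA; congr (_ + _).
rewrite /tens_mul !(tens_lift_pure (tens_mul_bal2 _)).
by rewrite (tens_liftD (tens_mul_bal1 a b)).
Qed.
Lemma tens_mul0r x : tens_mul x 0 = 0.
Proof. by apply: (addrI (tens_mul x 0)); rewrite -tens_mulDr !addr0. Qed.
Lemma tens_mul_pure a b a' b' :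
  tens_mul (tpure a b) (tpure a' b') = tpure (a * a') (b * b').
Proof.
rewrite /tens_mul !(tens_lift_pure (tens_mul_bal2 _)).
by rewrite (tens_lift_pure (tens_mul_bal1 a b)).
Qed.

Lemma tens_mulA : associative tens_mul.
Proof.
move=> x y z; elim/tens_ind: x => [|a b x IHx]; first by rewrite !tens_mul0l.
rewrite !tens_mulDl IHx; congr (_ + _) => {x IHx}.
elim/tens_ind: y => [|a' b' y IHy]; first by rewrite !(tens_mul0l, tens_mul0r).
rewrite !(tens_mulDl, tens_mulDr) IHy; congr (_ + _) => {y IHy}.
elim/tens_ind: z => [|a'' b'' z IHz]; first by rewrite !tens_mul0r.
by rewrite !tens_mulDr IHz !tens_mul_pure !mulrA.
Qed.
Lemma tens_mul1 : left_id (tpure 1 1) tens_mul.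
Proof.
elim/tens_ind => [|a b x IHx]; first by rewrite tens_mul0r.
by rewrite tens_mulDr IHx tens_mul_pure !mul1r.
Qed.
Lemma tens_mulr1 : right_id (tpure 1 1) tens_mul.
Proof.
elim/tens_ind => [|a b x IHx]; first by rewrite tens_mul0l.
by rewrite tens_mulDl IHx tens_mul_pure !mulr1.
Qed.

Lemma tens_oner_neq0 : tpure 1 1 != 0.
Proof.
have [f [fD fZ f1]] := exists_augmentation A.
have [g [gD gZ g1]] := exists_augmentation B.
have h_bal : balanced (fun a b => f a * g b).
  split=> [a a' b|a b b'|c a b]; first by rewrite fD mulrDl.
    by rewrite gD mulrDr.
  by rewrite fZ gZ mulrCA mulrA.
apply/eqP => /(congr1 (tens_lift (fun a b => f a * g b))) /eqP.
by rewrite (tens_lift_pure h_bal) (tens_lift0 h_bal) f1 g1 mulr1 oner_eq0.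
Qed.

HB.instance Definition _ := GRing.Zmodule_isNzRing.Build tens
  tens_mulA tens_mul1 tens_mulr1 tens_mulDl tens_mulDr tens_oner_neq0.

Lemma tens_scaleA c d x : tens_scale c (tens_scale d x) = tens_scale (c * d) x.
Proof.
elim/tens_ind: x => [|a b x IHx]; first by rewrite !tens_scale0.
by rewrite !tens_scaleD IHx !tens_scale_pure scalerA.
Qed.
Lemma tens_scale1 : left_id 1 tens_scale.
Proof.
elim/tens_ind => [|a b x IHx]; first by rewrite !tens_scale0.
by rewrite !tens_scaleD IHx !tens_scale_pure scale1r.
Qed.
Lemma tens_scaleDl x : {morph tens_scale^~ x : c d / c + d}.
Proof.
move=> c d; elim/tens_ind: x => [|a b x IHx]; first by rewrite !tens_scale0 addr0.
by rewrite !tens_scaleD IHx !tens_scale_pure scalerDl tpureDl addrACA.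
Qed.

HB.instance Definition _ := GRing.Zmodule_isLmodule.Build K tens
  tens_scaleA tens_scale1 tens_scaleD tens_scaleDl.

Lemma tens_scaleAl (c : K) (x y : tens) : c *: (x * y) = (c *: x) * y.
Proof.
rewrite -[LHS]/(tens_scale c (tens_mul x y)) -[RHS]/(tens_mul (tens_scale c x) y).
elim/tens_ind: x => [|a b x IHx].
  by rewrite !(tens_mul0l, tens_scale0, tens_mul0l).
rewrite !(tens_mulDl, tens_scaleD) IHx; congr (_ + _) => {x IHx}.
elim/tens_ind: y => [|a' b' y IHy]; first by rewrite !(tens_mul0r, tens_scale0).
rewrite !(tens_mulDr, tens_scaleD) IHy; congr (_ + _).
by rewrite !(tens_mul_pure, tens_scale_pure) scalerAl.
Qed.

HB.instance Definition _ := GRing.Lmodule_isLalgebra.Build K tens tens_scaleAl.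

Lemma tens_scaleAr (c : K) (x y : tens) : c *: (x * y) = x * (c *: y).
Proof.
rewrite -[LHS]/(tens_scale c (tens_mul x y)) -[RHS]/(tens_mul x (tens_scale c y)).
elim/tens_ind: x => [|a b x IHx]; first by rewrite !(tens_mul0l, tens_scale0).
rewrite !(tens_mulDl, tens_scaleD) IHx; congr (_ + _) => {x IHx}.
elim/tens_ind: y => [|a' b' y IHy]; first by rewrite !(tens_scale0, tens_mul0r).
rewrite !(tens_mulDr, tens_scaleD) IHy; congr (_ + _).
by rewrite !(tens_mul_pure, tens_scale_pure) scalerAr.
Qed.

HB.instance Definition _ := GRing.Lalgebra_isAlgebra.Build K tens tens_scaleAr.

Lemma tpureM a b a' b' : tpure a b * tpure a' b' = tpure (a * a') (b * b').
Proof. exact: tens_mul_pure. Qed.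
Lemma tpureZl (c : K) a b : tpure (c *: a) b = c *: tpure a b.
Proof. by rewrite -[RHS]/(tens_scale _ _) tens_scale_pure. Qed.
Lemma tpureZr (c : K) a b : tpure a (c *: b) = c *: tpure a b.
Proof. by rewrite -tpureZ tpureZl. Qed.

Definition tens_inl (a : A) : tens := tpure a 1.
Definition tens_inr (b : B) : tens := tpure 1 b.

Lemma tens_inl_is_zmod_morphism : zmod_morphism tens_inl.
Proof.
move=> a a'; apply/(addIr (tens_inl a')); rewrite subrK -tpureDl.
by rewrite subrK.
Qed.
Lemma tens_inl_is_monoid_morphism : monoid_morphism tens_inl.
Proof. by split=> // a a'; rewrite /tens_inl tpureM mulr1. Qed.
Lemma tens_inl_is_scalable : scalable tens_inl.
Proof. by move=> c a; rewrite /tens_inl tpureZl. Qed.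
HB.instance Definition _ := GRing.isZmodMorphism.Build A tens tens_inl
  tens_inl_is_zmod_morphism.
HB.instance Definition _ := GRing.isMonoidMorphism.Build A tens tens_inl
  tens_inl_is_monoid_morphism.
HB.instance Definition _ := GRing.isScalable.Build K A tens *:%R tens_inl
  tens_inl_is_scalable.

Lemma tens_inr_is_zmod_morphism : zmod_morphism tens_inr.
Proof.
move=> a a'; apply/(addIr (tens_inr a')); rewrite subrK -tpureDr.
by rewrite subrK.
Qed.
Lemma tens_inr_is_monoid_morphism : monoid_morphism tens_inr.
Proof. by split=> // a a'; rewrite /tens_inr tpureM mulr1. Qed.
Lemma tens_inr_is_scalable : scalable tens_inr.
Proof. by move=> c a; rewrite /tens_inr tpureZr. Qed.
HB.instance Definition _ := GRing.isZmodMorphism.Build B tens tens_inr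
  tens_inr_is_zmod_morphism.
HB.instance Definition _ := GRing.isMonoidMorphism.Build B tens tens_inr
  tens_inr_is_monoid_morphism.
HB.instance Definition _ := GRing.isScalable.Build K B tens *:%R tens_inr
  tens_inr_is_scalable.

Lemma tens_inlr a b : tens_inl a * tens_inr b = tpure a b.
Proof. by rewrite /tens_inl /tens_inr tpureM mulr1 mul1r. Qed.
Lemma tens_inrl a b : tens_inr b * tens_inl a = tpure a b.
Proof. by rewrite /tens_inl /tens_inr tpureM mulr1 mul1r. Qed.

(* The image of [M (x) N] in [A (x) B], for subspaces [M] and [N]. *)
Definition tens_sub (M : set A) (N : set B) : set tens :=
  [set x | exists s : seq (A * B),
     (forall p, p \in s -> M p.1 /\ N p.2) /\ x = \sum_(p <- s) tpure p.1 p.2].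

End Tensor.

Section Subalgebra.
Variables (K : fieldType) (A : algType K).

Definition is_subalgebra (M : set A) : Prop :=
  [/\ M 1, forall (c : K) x y, M x -> M y -> M (c *: x + y) &
      forall x y, M x -> M y -> M (x * y)].

Inductive subalg_gen (X : set A) : set A :=
| subalg_gen_mem x : X x -> subalg_gen X x
| subalg_gen1 : subalg_gen X 1
| subalg_gen_lin (c : K) x y :
    subalg_gen X x -> subalg_gen X y -> subalg_gen X (c *: x + y)
| subalg_genM x y : subalg_gen X x -> subalg_gen X y -> subalg_gen X (x * y).

Definition left_coideal_subalgebra (Delta : A -> tens A A) (M : set A) : Prop :=
  is_subalgebra M /\ (Delta @` M `<=` tens_sub setT M)%classic.

End Subalgebra.

(** * The quantized enveloping algebra of sp_2n *)

Section SpMatrices.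
Variables (K : fieldType) (q : K) (n : nat).

(* Indices start at 0, so that [i' = 2n - 1 - i] is [rev_ord i]. *)
Local Notation N := (2 * n)%N.

Definition sp_eps (i : 'I_N) : K := (-1) ^+ (n <= i)%N.

Definition sp_rho (i : 'I_N) : int := n%:Z - (i + (n <= i))%N%:Z.

Definition sp_D : 'M[K]_N := diag_mx (\row_i q ^ sp_rho i).

Definition sp_J : 'M[K]_N := diag_mx (\row_i sp_eps i).

Definition sp_R : 'M[K]_(N * N) :=
  \sum_(i < N) \sum_(j < N) q ^ ((i == j)%:Z - (i == rev_ord j)%:Z) *:
      (delta_mx i i *t delta_mx j j)
  + (q - q^-1) *: (\sum_(i < N) \sum_(j < N | (i < j)%N) delta_mx i j *t delta_mx j i)
  - (q - q^-1) *: (\sum_(i < N) \sum_(j < N | (i < j)%N)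
      (q ^ (sp_rho j - sp_rho i) * sp_eps i * sp_eps j) *:
        (delta_mx i j *t delta_mx (rev_ord i) (rev_ord j))).

Section OverAlgebra.
Variable A : algType K.

(* [e_ij^t = eps_i eps_j e_j'i'], read off on the entries. *)
Definition sp_tr (X : 'M[A]_N) : 'M[A]_N :=
  \matrix_(i, j) ((sp_eps i * sp_eps j) *: X (rev_ord j) (rev_ord i)).

Definition scal_mx m p (M : 'M[K]_(m, p)) : 'M[A]_(m, p) := map_mx (in_alg A) M.

(* [X_1] and [X_2]. *)
Definition fst_mx (X : 'M[A]_N) : 'M[A]_(N * N) := X *t 1%:M.
Definition snd_mx (X : 'M[A]_N) : 'M[A]_(N * N) := 1%:M *t X.

Local Notation R := (scal_mx sp_R).
Local Notation D := (scal_mx sp_D).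
Local Notation Dinv := (scal_mx (invmx sp_D)).

(* The defining relations of U_q(sp_2n) for [T = (t_ij)] and [Tb = (tbar_ij)],
   each written as the difference of its two sides, entry by entry. *)
Inductive sp_relator (T Tb : 'M[A]_N) : set A :=
| sp_rel_T0 (i j : 'I_N) of (i < j)%N : sp_relator T Tb (T i j)
| sp_rel_Tb0 (i j : 'I_N) of (i < j)%N : sp_relator T Tb (Tb j i)
| sp_rel_TTb i : sp_relator T Tb (T i i * Tb i i - 1)
| sp_rel_TbT i : sp_relator T Tb (Tb i i * T i i - 1)
| sp_rel_RTT i j : sp_relator T Tb
    ((R *m fst_mx T *m snd_mx T - snd_mx T *m fst_mx T *m R) i j)
| sp_rel_RTbTb i j : sp_relator T Tb
    ((R *m fst_mx Tb *m snd_mx Tb - snd_mx Tb *m fst_mx Tb *m R) i j)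
| sp_rel_RTbT i j : sp_relator T Tb
    ((R *m fst_mx Tb *m snd_mx T - snd_mx T *m fst_mx Tb *m R) i j)
| sp_rel_TD i j : sp_relator T Tb ((T *m D *m sp_tr T *m Dinv - 1%:M) i j)
| sp_rel_TbD i j : sp_relator T Tb ((Tb *m D *m sp_tr Tb *m Dinv - 1%:M) i j)
| sp_rel_DT i j : sp_relator T Tb ((D *m sp_tr T *m Dinv *m T - 1%:M) i j)
| sp_rel_DTb i j : sp_relator T Tb ((D *m sp_tr Tb *m Dinv *m Tb - 1%:M) i j).

Definition sp_relations (T Tb : 'M[A]_N) : Prop :=
  forall x, sp_relator T Tb x -> x = 0.

Lemma sp_relationsI (T Tb : 'M[A]_N) :
  (forall i j : 'I_N, (i < j)%N -> T i j = 0) ->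
  (forall i j : 'I_N, (i < j)%N -> Tb j i = 0) ->
  (forall i, T i i * Tb i i = 1) -> (forall i, Tb i i * T i i = 1) ->
  R *m fst_mx T *m snd_mx T = snd_mx T *m fst_mx T *m R ->
  R *m fst_mx Tb *m snd_mx Tb = snd_mx Tb *m fst_mx Tb *m R ->
  R *m fst_mx Tb *m snd_mx T = snd_mx T *m fst_mx Tb *m R ->
  T *m D *m sp_tr T *m Dinv = 1%:M -> Tb *m D *m sp_tr Tb *m Dinv = 1%:M ->
  D *m sp_tr T *m Dinv *m T = 1%:M -> D *m sp_tr Tb *m Dinv *m Tb = 1%:M ->
  sp_relations T Tb.
Proof.
move=> T0 Tb0 TTb TbT RTT RTbTb RTbT TD TbD DT DTb x.
case=> {x}; [exact: T0|exact: Tb0|move=> i|move=> i|move=> i j..].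
- by rewrite TTb subrr.
- by rewrite TbT subrr.
- by rewrite RTT subrr mxE.
- by rewrite RTbTb subrr mxE.
- by rewrite RTbT subrr mxE.
- by rewrite TD subrr mxE.
- by rewrite TbD subrr mxE.
- by rewrite DT subrr mxE.
- by rewrite DTb subrr mxE.
Qed.

Lemma sp_relationsE (T Tb : 'M[A]_N) : sp_relations T Tb ->
  [/\ forall i j : 'I_N, (i < j)%N -> T i j = 0, forall i j : 'I_N, (i < j)%N -> Tb j i = 0,
      forall i, T i i * Tb i i = 1 & forall i, Tb i i * T i i = 1] /\
  [/\ R *m fst_mx T *m snd_mx T = snd_mx T *m fst_mx T *m R,
      R *m fst_mx Tb *m snd_mx Tb = snd_mx Tb *m fst_mx Tb *m R &
      R *m fst_mx Tb *m snd_mx T = snd_mx T *m fst_mx Tb *m R] /\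
  [/\ T *m D *m sp_tr T *m Dinv = 1%:M, Tb *m D *m sp_tr Tb *m Dinv = 1%:M,
      D *m sp_tr T *m Dinv *m T = 1%:M & D *m sp_tr Tb *m Dinv *m Tb = 1%:M].
Proof.
move=> rel; have mx0 m (M M' : 'M[A]_m) :
    (forall i j, sp_relator T Tb ((M - M') i j)) -> M = M'.
  move=> H; apply/eqP; rewrite -subr_eq0; apply/eqP/matrixP => i j.
  by rewrite [RHS]mxE; apply/rel/H.
do ![split] => *; try (by apply: mx0 => i j; constructor).
- by apply: rel; constructor.
- by apply: rel; constructor.
- by apply: subr0_eq; apply: rel; constructor.
- by apply: subr0_eq; apply: rel; constructor.
Qed.

Definition mx_comm (X Y : 'M[A]_N) : Prop :=
  forall i j k l, X i j * Y k l = Y k l * X i j.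

Lemma sum_mxtens (F : 'I_(N * N) -> A) :
  \sum_k F k = \sum_i \sum_j F (mxtens_index (i, j)).
Proof.
rewrite (pair_bigA _ (fun i j => F (mxtens_index (i, j)))) /=.
rewrite (reindex (@mxtens_index N N)) /=; first by apply: eq_bigr => -[].
by exists (@mxtens_unindex N N) => ? _; rewrite (mxtens_indexK, mxtens_unindexK).
Qed.

Lemma fst_mxM X Y : fst_mx (X *m Y) = fst_mx X *m fst_mx Y.
Proof.
apply/matrixP => a b; rewrite !mxE mulr_suml.
rewrite sum_mxtens.
apply: eq_bigr => i _.
rewrite (bigD1 (mxtens_unindex a).2) //= big1 ?addr0 => [|j ja].
  by rewrite !mxE !mxtens_indexK /= eqxx mulr1n mulr1 mulrA.
by rewrite !mxE !mxtens_indexK /= eq_sym (negPf ja) mulr0n mulr0 mul0r.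
Qed.

Lemma snd_mxM X Y : snd_mx (X *m Y) = snd_mx X *m snd_mx Y.
Proof.
apply/matrixP => a b; rewrite !mxE mulr_sumr.
rewrite sum_mxtens.
rewrite [RHS](bigD1 (mxtens_unindex a).1) //= [X in _ + X]big1 ?addr0 => [|i ia].
  apply: eq_bigr => j _; rewrite !mxE !mxtens_indexK /= eqxx mulr1n mul1r.
  by rewrite !mulr_natl mulrnAr.
by rewrite big1 // => j _; rewrite !mxE !mxtens_indexK /= eq_sym (negPf ia) !mul0r.
Qed.

Lemma fst_snd_mxE X Y a b : (fst_mx X *m snd_mx Y) a b =
  X (mxtens_unindex a).1 (mxtens_unindex b).1 *
  Y (mxtens_unindex a).2 (mxtens_unindex b).2.
Proof.
rewrite !mxE (reindex (@mxtens_index N N)) /=; last first.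
  by exists (@mxtens_unindex N N) => ? _; rewrite (mxtens_indexK, mxtens_unindexK).
rewrite (bigD1 ((mxtens_unindex b).1, (mxtens_unindex a).2)) //= big1 ?addr0.
  by rewrite !mxE !mxtens_indexK /= !eqxx !mulr1n mulr1 mul1r.
case=> i j; rewrite xpair_eqE negb_and => /orP[ib|ja].
  by rewrite !mxE !mxtens_indexK /= (negPf ib) mulr0n mul0r mulr0.
by rewrite !mxE !mxtens_indexK /= eq_sym (negPf ja) mulr0n mulr0 mul0r.
Qed.

Lemma snd_fst_mxE X Y a b : (snd_mx Y *m fst_mx X) a b =
  Y (mxtens_unindex a).2 (mxtens_unindex b).2 *
  X (mxtens_unindex a).1 (mxtens_unindex b).1.
Proof.
rewrite !mxE (reindex (@mxtens_index N N)) /=; last first.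
  by exists (@mxtens_unindex N N) => ? _; rewrite (mxtens_indexK, mxtens_unindexK).
rewrite (bigD1 ((mxtens_unindex a).1, (mxtens_unindex b).2)) //= big1 ?addr0.
  by rewrite !mxE !mxtens_indexK /= !eqxx !mulr1n mulr1 mul1r.
case=> i j; rewrite xpair_eqE negb_and => /orP[ia|jb].
  by rewrite !mxE !mxtens_indexK /= eq_sym (negPf ia) mulr0n mul0r mul0r.
by rewrite !mxE !mxtens_indexK /= (negPf jb) mulr0n !mulr0.
Qed.

Lemma fst_snd_mxC X Y : mx_comm X Y ->
  fst_mx X *m snd_mx Y = snd_mx Y *m fst_mx X.
Proof.
by move=> XY; apply/matrixP => a b; rewrite fst_snd_mxE snd_fst_mxE XY.
Qed.

Lemma RTT_mul X X' Y Y' : mx_comm X' Y -> mx_comm X Y' ->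
  R *m fst_mx X *m snd_mx Y = snd_mx Y *m fst_mx X *m R ->
  R *m fst_mx X' *m snd_mx Y' = snd_mx Y' *m fst_mx X' *m R ->
  R *m fst_mx (X *m X') *m snd_mx (Y *m Y') =
  snd_mx (Y *m Y') *m fst_mx (X *m X') *m R.
Proof.
move=> X'Y XY' RXY RXY'; rewrite !fst_mxM !snd_mxM.
rewrite !mulmxA -(mulmxA _ (fst_mx X')) (fst_snd_mxC X'Y) !mulmxA RXY.
rewrite -(mulmxA _ _ (fst_mx X')) -(mulmxA _ (R *m _)) RXY'.
rewrite !mulmxA -(mulmxA _ (fst_mx X) (snd_mx Y')) (fst_snd_mxC XY').
by rewrite !mulmxA.
Qed.

Lemma sp_epsM i : sp_eps i * sp_eps i = 1.
Proof. by rewrite /sp_eps -expr2 sqrr_sign. Qed.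

Lemma sp_trM X Y : mx_comm X Y -> sp_tr (X *m Y) = sp_tr Y *m sp_tr X.
Proof.
move=> XY; apply/matrixP => i j; rewrite !mxE scaler_sumr.
rewrite (reindex_inj rev_ord_inj) /=; apply: eq_bigr => k _.
rewrite !mxE XY -scalerAl -scalerAr scalerA; congr (_ *: _).
by rewrite mulrACA -mulrA (mulrA (sp_eps k)) sp_epsM mul1r.
Qed.

Lemma sp_tr1 : sp_tr 1%:M = 1%:M.
Proof.
apply/matrixP => i j; rewrite !mxE (inj_eq rev_ord_inj) eq_sym.
by have [->|_] := eqVneq i j; rewrite ?sp_epsM ?scale1r // scaler0.
Qed.

Lemma fst_mx1 : fst_mx 1%:M = 1%:M.
Proof.
apply/matrixP => a b; case: (mxtens_indexP a) => i j; case: (mxtens_indexP b) => k l.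
by rewrite tensmxE !mxE (can_eq (@mxtens_indexK _ _)) xpair_eqE -natrM mulnb.
Qed.

Lemma snd_mx1 : snd_mx 1%:M = 1%:M.
Proof. exact: fst_mx1. Qed.

Hypothesis q_neq0 : q != 0.

Lemma sp_D_unit : sp_D \in unitmx.
Proof.
rewrite unitmxE det_diag unitfE prodf_seq_neq0; apply/allP => i _ /=.
by rewrite mxE expfz_neq0.
Qed.

Lemma scal_mxM m p r (M : 'M[K]_(m, p)) (M' : 'M[K]_(p, r)) :
  scal_mx (M *m M') = scal_mx M *m scal_mx M'.
Proof. exact: map_mxM. Qed.

Lemma sp_DDinv : D *m Dinv = 1%:M.
Proof. by rewrite -scal_mxM mulmxV ?sp_D_unit // /scal_mx map_mx1. Qed.

Lemma sp_DinvD : Dinv *m D = 1%:M.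
Proof. by rewrite -scal_mxM mulVmx ?sp_D_unit // /scal_mx map_mx1. Qed.

Lemma sp_TD_mul X Y : mx_comm X Y ->
  X *m D *m sp_tr X *m Dinv = 1%:M -> Y *m D *m sp_tr Y *m Dinv = 1%:M ->
  (X *m Y) *m D *m sp_tr (X *m Y) *m Dinv = 1%:M.
Proof.
move=> XY XD YD; have {}YD : Y *m D *m sp_tr Y = D.
  by rewrite -[LHS]mulmx1 -sp_DinvD mulmxA YD mul1mx.
by rewrite sp_trM // !mulmxA -(mulmxA X) -(mulmxA X) YD XD.
Qed.

Lemma sp_DT_mul X Y : mx_comm X Y ->
  D *m sp_tr X *m Dinv *m X = 1%:M -> D *m sp_tr Y *m Dinv *m Y = 1%:M ->
  D *m sp_tr (X *m Y) *m Dinv *m (X *m Y) = 1%:M.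
Proof.
move=> XY DX DY; have {}DX : sp_tr X *m Dinv *m X = Dinv.
  by rewrite -[LHS]mul1mx -sp_DinvD -mulmxA (mulmxA D) (mulmxA D) DX mulmx1.
rewrite sp_trM // !mulmxA -(mulmxA _ (sp_tr X)) -(mulmxA _ (_ *m _) X) DX.
by rewrite DY.
Qed.

Lemma sp_relations1 : sp_relations 1%:M 1%:M.
Proof.
apply: sp_relationsI; rewrite ?sp_tr1 ?fst_mx1 ?snd_mx1 ?mulmx1 ?mul1mx ?sp_DDinv //.
- by move=> i j ij; rewrite mxE -val_eqE /= (ltn_eqF ij).
- by move=> i j ij; rewrite mxE -val_eqE /= (gtn_eqF ij).
- by move=> i; rewrite !mxE eqxx mulr1.
- by move=> i; rewrite !mxE eqxx mulr1.
Qed.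

Lemma sp_relationsM T Tb U Ub :
  mx_comm T U -> mx_comm T Ub -> mx_comm Tb U -> mx_comm Tb Ub ->
  sp_relations T Tb -> sp_relations U Ub -> sp_relations (T *m U) (Tb *m Ub).
Proof.
move=> TU TUb TbU TbUb.
have [UT UbT UTb UbTb] : [/\ mx_comm U T, mx_comm Ub T, mx_comm U Tb & mx_comm Ub Tb].
  by split=> i j k l; rewrite (TU, TUb, TbU, TbUb).
move=> /sp_relationsE[[T0 Tb0 TTb TbT] [[RTT RTbTb RTbT] [TD TbD DT DTb]]].
move=> /sp_relationsE[[U0 Ub0 UUb UbU] [[RUU RUbUb RUbU] [UD UbD DU DUb]]].
have diagM i : (T *m U) i i = T i i * U i i.
  rewrite mxE (bigD1 i) //= big1 ?addr0 // => k; rewrite neq_ltn => /orP[ki|ik].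
    by rewrite U0 // mulr0.
  by rewrite T0 // mul0r.
have diagbM i : (Tb *m Ub) i i = Tb i i * Ub i i.
  rewrite mxE (bigD1 i) //= big1 ?addr0 // => k; rewrite neq_ltn => /orP[ki|ik].
    by rewrite Tb0 // mul0r.
  by rewrite Ub0 // mulr0.
apply: sp_relationsI.
- move=> i j ij; rewrite mxE big1 // => k _; have [ik|ki] := ltnP i k.
    by rewrite T0 // mul0r.
  by rewrite U0 ?mulr0 // (leq_ltn_trans ki).
- move=> i j ij; rewrite mxE big1 // => k _; have [kj|jk] := ltnP k j.
    by rewrite Tb0 // mul0r.
  by rewrite Ub0 ?mulr0 // (leq_trans ij).
- by move=> i; rewrite diagM diagbM mulrA -(mulrA (T i i)) UTb mulrA TTb mul1r UUb.
- by move=> i; rewrite diagM diagbM mulrA -(mulrA (Tb i i)) UbT mulrA TbT mul1r UbU.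
- exact: RTT_mul.
- exact: RTT_mul.
- exact: RTT_mul.
- exact: sp_TD_mul.
- exact: sp_TD_mul.
- exact: sp_DT_mul.
- exact: sp_DT_mul.
Qed.

End OverAlgebra.

Section Morphism.
Variables (A B : algType K) (f : {lrmorphism A -> B}).

Lemma map_scal_mx m p (M : 'M[K]_(m, p)) : map_mx f (scal_mx A M) = scal_mx B M.
Proof. by apply/matrixP => i j; rewrite !mxE /= rmorph_alg. Qed.

Lemma map_fst_mx X : map_mx f (fst_mx X) = fst_mx (map_mx f X).
Proof. by rewrite map_mxT map_mx1. Qed.

Lemma map_snd_mx X : map_mx f (snd_mx X) = snd_mx (map_mx f X).
Proof. by rewrite map_mxT map_mx1. Qed.

Lemma map_sp_tr X : map_mx f (sp_tr X) = sp_tr (map_mx f X).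
Proof. by apply/matrixP => i j; rewrite !mxE linearZ. Qed.

Lemma map_sp_relator T Tb x : sp_relator T Tb x ->
  sp_relator (map_mx f T) (map_mx f Tb) (f x).
Proof.
have E m p (M : 'M[A]_(m, p)) i j : f (M i j) = map_mx f M i j by rewrite mxE.
pose mapE := (map_mxM f, map_scal_mx, map_fst_mx, map_snd_mx, map_sp_tr, map_mx1 f).
case=> {x} [i j ij|i j ij|i|i|i j|i j|i j|i j|i j|i j|i j];
  rewrite ?rmorphB ?rmorphM ?rmorph1 /= ?E; try (by constructor).
all: by rewrite map_mxB !mapE; constructor.
Qed.

Lemma map_sp_relations T Tb T' Tb' :
  map_mx f T = T' -> map_mx f Tb = Tb' -> sp_relations T' Tb' ->
  forall x, sp_relator T Tb x -> f x = 0.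
Proof. by move=> <- <- rel x /map_sp_relator/rel. Qed.

Lemma sp_relations_map T Tb :
  (forall x, sp_relator T Tb x -> f x = 0) ->
  sp_relations (map_mx f T) (map_mx f Tb).
Proof.
move=> rel; suff H y : sp_relator (map_mx f T) (map_mx f Tb) y ->
    exists2 x, sp_relator T Tb x & y = f x.
  by move=> y /H[x /rel fx ->].
have E m p (M : 'M[A]_(m, p)) i j : f (M i j) = map_mx f M i j by rewrite mxE.
pose mapE := (map_mxM f, map_scal_mx, map_fst_mx, map_snd_mx, map_sp_tr, map_mx1 f).
case=> {y} [i j ij|i j ij|i|i|i j|i j|i j|i j|i j|i j|i j].
- by exists (T i j); [exact: sp_rel_T0|rewrite E].
- by exists (Tb j i); [exact: sp_rel_Tb0|rewrite E].
- exists (T i i * Tb i i - 1); first exact: sp_rel_TTb.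
  by rewrite rmorphB rmorphM rmorph1 /= !E.
- exists (Tb i i * T i i - 1); first exact: sp_rel_TbT.
  by rewrite rmorphB rmorphM rmorph1 /= !E.
all: eexists; [|rewrite -!mapE -map_mxB -E; reflexivity].
- exact: sp_rel_RTT.
- exact: sp_rel_RTbTb.
- exact: sp_rel_RTbT.
- exact: sp_rel_TD.
- exact: sp_rel_TbD.
- exact: sp_rel_DT.
- exact: sp_rel_DTb.
Qed.

End Morphism.
End SpMatrices.

Section Presentation.
Variables (K : fieldType) (q : K) (q_neq0 : q != 0) (n : nat).
Local Notation N := (2 * n)%N.

(* [(false, i, j)] stands for [t_ij] and [(true, i, j)] for [tbar_ij]. *)
Definition sp_gen : choiceType := (bool * 'I_N * 'I_N)%type.
Local Notation F := (free_alg K sp_gen).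

Definition sp_freeT : 'M[F]_N := \matrix_(i, j) free_gen K ((false, i, j) : sp_gen).
Definition sp_freeTb : 'M[F]_N := \matrix_(i, j) free_gen K ((true, i, j) : sp_gen).

Section UniversalProperty.
Variables (A : algType K) (T Tb : 'M[A]_N).

Definition sp_free_lift : {lrmorphism F -> A} :=
  free_lift (fun g : sp_gen => if g.1.1 then Tb g.1.2 g.2 else T g.1.2 g.2).

Lemma sp_free_liftT : map_mx sp_free_lift sp_freeT = T.
Proof.
apply/matrixP => i j; rewrite mxE [X in sp_free_lift X]mxE.
exact: free_lift_gen.
Qed.

Lemma sp_free_liftTb : map_mx sp_free_lift sp_freeTb = Tb.
Proof.
apply/matrixP => i j; rewrite mxE [X in sp_free_lift X]mxE.
exact: free_lift_gen.
Qed.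

Lemma sp_free_lift0 : sp_relations q T Tb ->
  forall x, sp_relator q sp_freeT sp_freeTb x -> sp_free_lift x = 0.
Proof.
move=> rel; exact: map_sp_relations sp_free_liftT sp_free_liftTb rel.
Qed.

End UniversalProperty.

Lemma Uq_sp_proper : ~ ideal_gen (sp_relator q sp_freeT sp_freeTb) 1.
Proof.
have rel := @sp_relations1 K q n K^o q_neq0.
move=> /(ideal_gen_ker (sp_free_lift0 rel)) /eqP.
by rewrite rmorph1 oner_eq0.
Qed.

Definition Uq_sp : algType K := quot_alg Uq_sp_proper.

End Presentation.

HB.lock Definition sp_T (K : fieldType) (q : K) (q_neq0 : q != 0) (n : nat) :
    'M[Uq_sp q_neq0 n]_(2 * n) :=
  map_mx (quot_pi (@Uq_sp_proper _ _ q_neq0 n)) (sp_freeT K n).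

HB.lock Definition sp_Tb (K : fieldType) (q : K) (q_neq0 : q != 0) (n : nat) :
    'M[Uq_sp q_neq0 n]_(2 * n) :=
  map_mx (quot_pi (@Uq_sp_proper _ _ q_neq0 n)) (sp_freeTb K n).

Section Coproduct.
Variables (K : fieldType) (q : K) (q_neq0 : q != 0) (n : nat).
Local Notation N := (2 * n)%N.
Local Notation F := (free_alg K (sp_gen n)).
Local Notation Uq_sp := (Uq_sp q_neq0 n).
Local Notation sp_T := (sp_T q_neq0 n).
Local Notation sp_Tb := (sp_Tb q_neq0 n).

Definition sp_S : 'M[Uq_sp]_N := sp_T *m scal_mx Uq_sp (sp_J K n) *m sp_Tb^T.

Definition Uq_tw : set Uq_sp := subalg_gen [set x | exists i j, x = sp_S i j].

Lemma sp_T_relations : sp_relations q sp_T sp_Tb.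
Proof.
rewrite sp_T.unlock sp_Tb.unlock.
exact: sp_relations_map (@quot_pi0 _ _ _ (@Uq_sp_proper _ _ q_neq0 n)).
Qed.

Definition sp_copT : 'M[tens Uq_sp Uq_sp]_N :=
  \matrix_(i, j) \sum_k tpure (sp_T i k) (sp_T k j).
Definition sp_copTb : 'M[tens Uq_sp Uq_sp]_N :=
  \matrix_(i, j) \sum_k tpure (sp_Tb i k) (sp_Tb k j).

Lemma sp_cop_relations : sp_relations q sp_copT sp_copTb.
Proof.
pose inl := map_mx (@tens_inl K Uq_sp Uq_sp); pose inr := map_mx (@tens_inr K Uq_sp Uq_sp).
have E (X : 'M[Uq_sp]_N) :
    inl _ _ X *m inr _ _ X = \matrix_(i, j) \sum_k tpure (X i k) (X k j).
  apply/matrixP => i j; rewrite mxE [RHS]mxE; apply: eq_bigr => k _.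
  by rewrite mxE [X in _ * X]mxE; apply: tens_inlr.
have C (X Y : 'M[Uq_sp]_N) : mx_comm (inl _ _ X) (inr _ _ Y).
  move=> i j k l; rewrite mxE [inr _ _ _ _ _]mxE.
  exact: etrans (tens_inlr _ _) (esym (tens_inrl _ _)).
apply: (eq_ind _ (fun X => sp_relations q X sp_copTb) _ _ (E sp_T)).
apply: (eq_ind _ (sp_relations q _) _ _ (E sp_Tb)).
apply: sp_relationsM; try exact: C.
- exact: q_neq0.
- apply: (@sp_relations_map K q n Uq_sp _ (@tens_inl K Uq_sp Uq_sp)).
  by move=> x /sp_T_relations ->; apply: raddf0.
- apply: (@sp_relations_map K q n Uq_sp _ (@tens_inr K Uq_sp Uq_sp)).
  by move=> x /sp_T_relations ->; apply: raddf0.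
Qed.

End Coproduct.

(* The algebra morphism [Delta'] determined by its values on the generators. *)
HB.lock Definition coproduct (K : fieldType) (q : K) (q_neq0 : q != 0) (n : nat) :
    {lrmorphism Uq_sp q_neq0 n -> tens (Uq_sp q_neq0 n) (Uq_sp q_neq0 n)} :=
  quot_lift (sp_free_lift0 (@sp_cop_relations K q q_neq0 n)).

Section CoproductTheory.
Variables (K : fieldType) (q : K) (q_neq0 : q != 0) (n : nat).
Local Notation N := (2 * n)%N.
Local Notation sp_T := (sp_T q_neq0 n).
Local Notation sp_Tb := (sp_Tb q_neq0 n).
Local Notation sp_S := (sp_S q_neq0 n).
Local Notation coproduct := (coproduct q_neq0 n).

Lemma coproduct_pi x : coproduct (quot_pi (@Uq_sp_proper _ _ q_neq0 n) x) =
  sp_free_lift (sp_copT q_neq0 n) (sp_copTb q_neq0 n) x.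
Proof.
rewrite unlock.
exact: (quot_lift_pi (@Uq_sp_proper _ _ q_neq0 n) (sp_free_lift0 (@sp_cop_relations K q q_neq0 n)) x).
Qed.

Lemma coproduct_T i j :
  coproduct (sp_T i j) = \sum_k tpure (sp_T i k) (sp_T k j).
Proof.
rewrite [in LHS]sp_T.unlock [X in coproduct X]mxE.
apply: etrans (coproduct_pi _) _.
have /matrixP/(_ i j) := sp_free_liftT (sp_copT q_neq0 n) (sp_copTb q_neq0 n).
by rewrite mxE => ->; rewrite mxE.
Qed.

Lemma coproduct_Tb i j :
  coproduct (sp_Tb i j) = \sum_k tpure (sp_Tb i k) (sp_Tb k j).
Proof.
rewrite [in LHS]sp_Tb.unlock [X in coproduct X]mxE.
apply: etrans (coproduct_pi _) _.
have /matrixP/(_ i j) := sp_free_liftTb (sp_copT q_neq0 n) (sp_copTb q_neq0 n).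
by rewrite mxE => ->; rewrite mxE.
Qed.

Lemma sp_SE i j : sp_S i j =
  \sum_(k < N | (j <= k <= i)%N) sp_eps K k *: (sp_T i k * sp_Tb j k).
Proof.
have [[T0 Tb0 _ _] _] := sp_relationsE (@sp_T_relations K q q_neq0 n).
have TJ k : (sp_T *m scal_mx _ (sp_J K n)) i k = sp_eps K k *: sp_T i k.
  rewrite /scal_mx map_diag_mx mul_mx_diag mxE [X in _ * X]mxE [X in _ * X]/= [X in X%:A]mxE.
  exact: mulr_algr.
rewrite [LHS]mxE [RHS]big_mkcond; apply: eq_bigr => k _.
rewrite TJ [sp_Tb^T _ _]mxE -scalerAl; case: ifP => // /negbT.
rewrite negb_and -!ltnNge.
by case/orP => [/Tb0|/T0] ->; rewrite ?mulr0 ?mul0r scaler0.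
Qed.

End CoproductTheory.

Arguments Uq_tw {K q} q_neq0 n _.

(* The field C(q), with C = R[i]. *)
Definition Cq (R : realType) : fieldType := {fraction {poly R[i]}}.

Definition Cq_q (R : realType) : Cq R := tofrac 'X.

Lemma Cq_q_neq0 (R : realType) : Cq_q R != 0.
Proof. by rewrite /Cq_q (@tofrac_eq0 {poly R[i]}) polyX_eq0. Qed.

(* Main.v *)
Require Import Defs.
From HB Require Import structures.
From mathcomp Require Import all_boot all_order all_algebra.
From mathcomp Require Import boolp classical_sets reals.

Set Implicit Arguments.
Unset Strict Implicit.
Unset Printing Implicit Defensive.

Import GRing.Theory.
Local Open Scope ring_scope.

(** Write [S i j] as the sum over all [m] of the sign of [m] times [T i m * Tb j m]. Since [Delta]
    is multiplicative, [Delta (S i j)] is a triple sum over [k], [l], [m] of the sign of [m] times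
    [T i k * Tb j l] tensor [T k m * Tb l m]. The left leg is free of [m], so summing over [m] first
    rebuilds [S k l] in the right leg ([coproduct_S]). For the coideal property, the elements that
    [Delta] sends into the image of the tensor product of the whole algebra with [Uq_tw] form a
    subalgebra; by the formula it contains the generators, hence all of [Uq_tw]. *)

Section Subalgebra.
Variables (K : fieldType) (A : algType K).

Lemma subalg_gen_subalgebra (X : set A) : is_subalgebra (subalg_gen X).
Proof.
split; [exact: subalg_gen1|exact: subalg_gen_lin|exact: subalg_genM].
Qed.

Lemma subalg_gen_min (X M : set A) :
  is_subalgebra M -> (X `<=` M)%classic -> (subalg_gen X `<=` M)%classic.
Proof.
case=> M1 Mlin MM XM x; elim=> {x} [x /XM //|//|c x y _ Mx _ My|x y _ Mx _ My].
  exact: Mlin.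
exact: MM.
Qed.

Lemma subalgebra_preimage (B : algType K) (f : {lrmorphism A -> B}) (M : set B) :
  is_subalgebra M -> is_subalgebra (f @^-1` M)%classic.
Proof.
case=> M1 Mlin MM; split=> [|c x y Mx My|x y Mx My] /=.
- by rewrite rmorph1.
- by rewrite linearP; apply: Mlin.
- by rewrite rmorphM; apply: MM.
Qed.

End Subalgebra.

Section TensorSubspace.
Variables (K : fieldType) (A B : algType K) (M : set A) (N : set B).

Lemma tens_sub_pure a b : M a -> N b -> tens_sub M N (tpure a b).
Proof.
move=> Ma Nb; exists [:: (a, b)]; split; last by rewrite big_seq1.
by move=> p; rewrite inE => /eqP ->.
Qed.

Lemma tens_sub0 : tens_sub M N 0.
Proof. by exists [::]; rewrite big_nil. Qed.

Lemma tens_subD x y : tens_sub M N x -> tens_sub M N y -> tens_sub M N (x + y).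
Proof.
move=> [s [Ms ->]] [t [Mt ->]]; exists (s ++ t); rewrite big_cat; split=> // p.
by rewrite mem_cat => /orP[/Ms|/Mt].
Qed.

(** The premise keeps [i \in r] because the legs of a representing list are known to lie in [M] and
    [N] only for its members. *)
Lemma tens_sub_sum (I : eqType) (r : seq I) (P : pred I) (F : I -> tens A B) :
  (forall i, i \in r -> P i -> tens_sub M N (F i)) ->
  tens_sub M N (\sum_(i <- r | P i) F i).
Proof.
move=> NF; rewrite big_seq_cond.
by apply: big_ind => [||i /andP[]]; [exact: tens_sub0|exact: tens_subD|exact: NF].
Qed.

Lemma tens_sub_subalgebra :
  is_subalgebra M -> is_subalgebra N -> is_subalgebra (tens_sub M N).
Proof.
(* Closure is stated for [c *: x + y] only, so closure under scaling needs [0], obtained as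
   [-1 *: 1 + 1]. *)
move=> [M1 Mlin MM] [N1 Nlin NM]; have M0 : M 0.
  by have := Mlin (-1) _ _ M1 M1; rewrite scaleN1r addNr.
split=> [|c x y [s [Ms ->]] Ny|x y [s [Ms ->]] [t [Mt ->]]].
- exact: tens_sub_pure.
- apply: tens_subD => //; rewrite scaler_sumr; apply: tens_sub_sum => p /Ms[Mp Np] _.
  rewrite -tpureZl; apply: tens_sub_pure => //.
  by rewrite -[_ *: _]addr0; apply: Mlin.
- rewrite mulr_suml; apply: tens_sub_sum => p /Ms[Mp Np] _.
  rewrite mulr_sumr; apply: tens_sub_sum => p' /Mt[Mp' Np'] _.
  by rewrite tpureM; apply: tens_sub_pure; [exact: MM|exact: NM].
Qed.

End TensorSubspace.

Lemma tpure_sumr (K : fieldType) (A B : algType K) (I : Type)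
  (r : seq I) (P : pred I) (a : A) (F : I -> B) :
  tpure a (\sum_(i <- r | P i) F i) = \sum_(i <- r | P i) tpure a (F i).
Proof.
apply: (big_morph (tpure a)) => [b b'|]; first exact: tpureDr.
by apply: (addrI (tpure a 0)); rewrite -tpureDr !addr0.
Qed.

Section CoproductS.
Variables (K : fieldType) (q : K) (q_neq0 : q != 0) (n : nat).
Local Notation T := (sp_T q_neq0 n).
Local Notation Tb := (sp_Tb q_neq0 n).
Local Notation S := (sp_S q_neq0 n).
Local Notation Delta := (coproduct q_neq0 n).

(** Triangularity of [T] and [Tb] kills the terms outside [j <= m <= i]. With a range independent of
    [i] and [j], the sums can be exchanged freely. *)
Lemma sp_S_sum i j : S i j = \sum_m sp_eps K m *: (T i m * Tb j m).
Proof.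
have [[T0 Tb0 _ _] _] := sp_relationsE (@sp_T_relations K q q_neq0 n).
rewrite sp_SE big_mkcond; apply: eq_bigr => m _; case: ifP => // /negbT.
rewrite negb_and -!ltnNge.
by case/orP => [/Tb0|/T0] ->; rewrite ?mulr0 ?mul0r scaler0.
Qed.

Lemma coproduct_S i j :
  Delta (S i j) = \sum_k \sum_l tpure (T i k * Tb j l) (S k l).
Proof.
rewrite sp_S_sum linear_sum.
under eq_bigr => m _.
  rewrite linearZ /= rmorphM /= coproduct_T coproduct_Tb mulr_suml scaler_sumr.
  under eq_bigr => k _ do rewrite mulr_sumr scaler_sumr.
  over.
rewrite exchange_big; apply: eq_bigr => k _.
rewrite exchange_big; apply: eq_bigr => l _.
(* For fixed [k] and [l], the sum over [m] and its signs are absorbed by the right leg. *)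
rewrite sp_S_sum tpure_sumr; apply: eq_bigr => m _.
by rewrite tpureM tpureZr.
Qed.

Lemma Uq_tw_left_coideal : left_coideal_subalgebra Delta (Uq_tw q_neq0 n).
Proof.
have twA : is_subalgebra (Uq_tw q_neq0 n) by exact: subalg_gen_subalgebra.
split=> // _ [x tw_x <-].
(* Stated as an inclusion in a preimage, the claim reduces to generators by minimality of
   [subalg_gen]. *)
suff : (Uq_tw q_neq0 n `<=` Delta @^-1` tens_sub setT (Uq_tw q_neq0 n))%classic.
  exact.
apply: subalg_gen_min => [|_ [i [j ->]] /=].
  by apply: subalgebra_preimage; apply: tens_sub_subalgebra.
rewrite coproduct_S; apply: tens_sub_sum => k _ _.
apply: tens_sub_sum => l _ _; apply: tens_sub_pure => //.
by apply: subalg_gen_mem; exists k, l.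
Qed.

End CoproductS.

Theorem proposition3p3 (R : realType) (n : nat) (n_ge1 : (1 <= n)%N) :
  let q_neq0 := Cq_q_neq0 R in
  let Delta := coproduct q_neq0 n in
  let t := sp_T q_neq0 n in
  let tbar := sp_Tb q_neq0 n in
  let s := sp_S q_neq0 n in
  left_coideal_subalgebra Delta (Uq_tw q_neq0 n) /\
  forall i j : 'I_(2 * n),
    Delta (s i j) =
    \sum_(k < 2 * n) \sum_(l < 2 * n) tpure (t i k * tbar j l) (s k l).
Proof.
split; first exact: Uq_tw_left_coideal.
exact: coproduct_S.
Qed.
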